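(* Let $q^-\le q^+$ be projections in $N$ such that $F=\Psi([q^-,q^+])$ is a face of the spectral scale $B$. Then $F$ is a sharp face if and only if there are linearly independent spectral pairs $(s_1,\mathbf t_1)$ and $(s_2,\mathbf t_2)$ and real numbers $\alpha_1,\alpha_2$ such that, for $i=1,2$, $P(s_i,\mathbf t_i,\alpha_i)$ is a hyperplane of support for $B$ with $B\subset P^{\uparrow}(s_i,\mathbf t_i,\alpha_i)$, and $$F\subset P(s_1,\mathbf t_1,\alpha_1)\cap P(s_2,\mathbf t_2,\alpha_2).$$ In this case, if we write $r_1=q^-$, $r_2=q^+-q^-$ and $r_3=1-q^+$, then (1) $r_1+r_2+r_3=1$, (2) $b_{\mathbf t_i}r_1\le s_ir_1$, (3) $b_{\mathbf t_i}r_2=s_ir_2$, and (4) $b_{\mathbf t_i}r_3\ge s_ir_3$ for $i=1,2$, and $r_1,r_2,r_3$ commute with $b_{\mathbf t_1}$ and $b_{\mathbf t_2}$.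
   Context: $M$ is a finite von Neumann algebra with a faithful normal tracial state $\tau$, $n$ is a positive integer, and $b_1,\dots,b_n\in M$ are self-adjoint; $N$ is the von Neumann subalgebra of $M$ generated by $b_1,\dots,b_n$ and $1$. $M_1^+=\{a\in M:0\le a\le 1\}$, $\Psi(a)=(\tau(a),\tau(b_1a),\dots,\tau(b_na))$, and $B=\Psi(M_1^+)\subset\mathbb R^{n+1}$ (the spectral scale) is compact and convex. For projections $p\le q$ in $M$, $[p,q]=\{a\in M_1^+:p\le a\le q\}$. (Every face of $B$ is of the form $\Psi([q^-,q^+])$ with $q^-\le q^+$ projections in $N$.) For nonzero $\mathbf t\in\mathbb R^n$, $b_{\mathbf t}=t_1b_1+\cdots+t_nb_n$. A spectral pair is a pair $(s,\mathbf t)$ with $s\in\mathbb R$ and $\mathbf t\in\mathbb R^n$ nonzero, regarded as a vector in $\mathbb R^{n+1}$ for linear independence. $P(s,\mathbf t,\alpha)$ is the hyperplane $-sx_0+t_1x_1+\cdots+t_nx_n=\alpha$ in $\mathbb R^{n+1}$ and $P^{\uparrow}(s,\mathbf t,\alpha)$ is the half-space $-sx_0+t_1x_1+\cdots+t_nx_n\ge\alpha$. A hyperplane of support for a convex set $C$ is a hyperplane meeting the boundary of $C$ with $C$ in one of its closed half-spaces. A face of a convex set is sharp if it is contained in two or more (distinct) hyperplanes of support. *)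

(* Defs.v *)
From HB Require Import structures.
From mathcomp Require Import all_boot all_order all_algebra.
From mathcomp Require Import complex.
From mathcomp Require Import all_classical all_reals all_analysis.

Set Implicit Arguments.
Unset Strict Implicit.
Unset Printing Implicit Defensive.

Import Order.TTheory GRing.Theory Num.Theory.
Import numFieldNormedType.Exports.

Local Open Scope classical_set_scope.
Local Open Scope ring_scope.

(* A Hilbert space is a complete normed space [H] over [R[i]] whose norm comes
   from an inner product [dot], linear in its first argument. Operators are
   bare functions [H -> H]; sums and scalar multiples are the pointwise ones
   and the product is composition, so that the unit is [idfun]. *)

Section Operators.
Context {R : realType} {H : completeNormedModType R[i]}.
Variable dot : {dot H for Num.conj}.

Definition hilbert_norm : Prop := forall x : H, `|x| ^+ 2 = dot x x.

Definition bounded_operator (a : H -> H) : Prop :=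
  linear a /\ exists K : R, forall x, `|a x| <= K%:C%C * `|x|.

Definition adjoint (a a' : H -> H) : Prop := forall x y, dot (a x) y = dot x (a' y).

Definition self_adjoint (a : H -> H) : Prop := adjoint a a.

(* The order of R[i] makes [0 <= z] say that z is real and nonnegative, so on a
   complex space [ople a c] forces c - a to be self-adjoint. *)
Definition ople (a c : H -> H) : Prop := forall x, 0 <= dot ((c - a) x) x.

Definition projection (p : H -> H) : Prop := p \o p = p /\ self_adjoint p.

Definition commutant (S : set (H -> H)) : set (H -> H) :=
  [set a | bounded_operator a /\ forall c, S c -> a \o c = c \o a].

(* A self-adjoint set of bounded operators equal to its double commutant; this
   makes it a unital algebra. *)
Definition von_neumann_algebra (M : set (H -> H)) : Prop :=
  (forall a, M a -> exists2 a', M a' & adjoint a a') /\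
  commutant (commutant M) = M.

Definition vN_generated (M S : set (H -> H)) : set (H -> H) :=
  \bigcap_(A in [set A | [/\ von_neumann_algebra A, A `<=` M & S `<=` A]]) A.

Definition finite_vN (M : set (H -> H)) : Prop :=
  forall v v', M v -> M v' -> adjoint v v' -> v' \o v = idfun -> v \o v' = idfun.

Definition directed (D : set (H -> H)) : Prop :=
  D !=set0 /\
  forall a c, D a -> D c -> exists d, [/\ D d, ople a d & ople c d].

Definition is_lub_in (M D : set (H -> H)) (a : H -> H) : Prop :=
  [/\ M a, self_adjoint a, (forall d, D d -> ople d a) &
      forall c, M c -> self_adjoint c -> (forall d, D d -> ople d c) -> ople a c].

(* Only the values of [tau] on [M] matter. Normality is stated for upward
   directed sets, that is, for increasing nets indexed by their range. *)
Record faithful_normal_tracial_state (M : set (H -> H)) (tau : (H -> H) -> R[i])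
    : Prop := {
  state_linear : forall (k : R[i]) a c, M a -> M c ->
    tau (k *: a + c) = k * tau a + tau c ;
  state_ge0 : forall a, M a -> ople 0 a -> 0 <= tau a ;
  state_unit : tau idfun = 1 ;
  state_trace : forall a c, M a -> M c -> tau (a \o c) = tau (c \o a) ;
  state_faithful : forall a, M a -> ople 0 a -> tau a = 0 -> a = 0 ;
  state_normal : forall (D : set (H -> H)) a,
    (forall d, D d -> M d /\ ople 0 d) -> directed D -> is_lub_in M D a ->
    complex.Re (tau a) = sup [set complex.Re (tau d) | d in D]
}.

Definition op_unit_interval (M : set (H -> H)) : set (H -> H) :=
  [set a | [/\ M a, ople 0 a & ople a idfun]].

Definition op_interval (M : set (H -> H)) (p q : H -> H) : set (H -> H) :=
  [set a | [/\ op_unit_interval M a, ople p a & ople a q]].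

(* Coordinate 0 is tau(a), coordinate j+1 is tau(b_j a). Real parts only serve
   to land in R^(n+1): both numbers are real when a >= 0 and b_j is
   self-adjoint. *)
Definition Psi n (tau : (H -> H) -> R[i]) (b : 'I_n -> H -> H) (a : H -> H)
    : 'rV[R]_(1 + n) :=
  row_mx (complex.Re (tau a))%:M (\row_(j < n) complex.Re (tau (b j \o a))).

Definition spectral_scale n (M : set (H -> H)) (tau : (H -> H) -> R[i])
    (b : 'I_n -> H -> H) : set 'rV[R]_(1 + n) :=
  Psi tau b @` op_unit_interval M.

Definition lin_comb n (b : 'I_n -> H -> H) (t : 'rV[R]_n) : H -> H :=
  \sum_(j < n) (t 0 j)%:C%C *: b j.

End Operators.

Section Convex.
Context {R : realType}.

Definition hyperplane m (c : 'rV[R]_m) (alpha : R) : set 'rV[R]_m :=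
  [set x | \sum_(i < m) c 0 i * x 0 i = alpha].

Definition upper_half_space m (c : 'rV[R]_m) (alpha : R) : set 'rV[R]_m :=
  [set x | \sum_(i < m) c 0 i * x 0 i >= alpha].

Definition lower_half_space m (c : 'rV[R]_m) (alpha : R) : set 'rV[R]_m :=
  [set x | \sum_(i < m) c 0 i * x 0 i <= alpha].

Definition boundary m (C : set 'rV[R]_m) : set 'rV[R]_m :=
  closure C `\` interior C.

Definition hyperplane_of_support m (C P : set 'rV[R]_m) : Prop :=
  P `&` boundary C !=set0 /\
  exists c alpha, [/\ c != 0, P = hyperplane c alpha &
    C `<=` upper_half_space c alpha \/ C `<=` lower_half_space c alpha].

Definition is_face m (C F : set 'rV[R]_m) : Prop :=
  [/\ F `<=` C, convex_set (F : set (convex_lmodType 'rV[R]_m)) &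
      forall (x y : 'rV[R]_m) (l : R), C x -> C y -> 0 < l < 1 ->
        F (l *: x + (1 - l) *: y) -> F x /\ F y].

Definition is_sharp_face m (C F : set 'rV[R]_m) : Prop :=
  is_face C F /\
  exists P1 P2, [/\ P1 <> P2, hyperplane_of_support C P1,
    hyperplane_of_support C P2, F `<=` P1 & F `<=` P2].

Definition spectral_vector n (s : R) (t : 'rV[R]_n) : 'rV[R]_(1 + n) :=
  row_mx s%:M t.

Definition spectral_hyperplane n (s : R) (t : 'rV[R]_n) (alpha : R) :
    set 'rV[R]_(1 + n) :=
  [set x | - s * x 0 (lshift n 0) + \sum_(j < n) t 0 j * x 0 (rshift 1 j) = alpha].

Definition spectral_half_space n (s : R) (t : 'rV[R]_n) (alpha : R) :
    set 'rV[R]_(1 + n) :=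
  [set x | - s * x 0 (lshift n 0) + \sum_(j < n) t 0 j * x 0 (rshift 1 j) >= alpha].

Definition independent_spectral_pairs n (s1 : R) (t1 : 'rV[R]_n) (s2 : R)
    (t2 : 'rV[R]_n) : Prop :=
  [/\ t1 != 0, t2 != 0 &
      free [:: spectral_vector s1 t1; spectral_vector s2 t2]].

Definition spectral_support n (B F : set 'rV[R]_(1 + n)) (s : R) (t : 'rV[R]_n)
    (alpha : R) : Prop :=
  [/\ hyperplane_of_support B (spectral_hyperplane s t alpha),
      B `<=` spectral_half_space s t alpha &
      F `<=` spectral_hyperplane s t alpha].

End Convex.

(* Main.v *)
Require Import Defs.
From HB Require Import structures.
From mathcomp Require Import all_boot all_order all_algebra.
From mathcomp Require Import complex.
From mathcomp Require Import all_classical all_reals all_analysis.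
From mathcomp Require Import ring lra.

Import Order.TTheory GRing.Theory Num.Theory.
Import numFieldNormedType.Exports.

Local Open Scope classical_set_scope.
Local Open Scope ring_scope.

(** A point x of the half-space bounded by the hyperplane of the spectral pair
    (s, t) is tested through the operator c = b_t - s: for x = Psi(a) the linear
    form of the hyperplane takes the value Re tau(c a) (lform_Psi). A supporting
    hyperplane with B above it and F inside it therefore says that q^- and q^+,
    like every element of [q^-, q^+], minimize a |-> tau(c a) over the operators
    0 <= a <= 1 of M. The order relations and commutation relations are the
    optimality conditions of this minimization problem.

    First order: let the projection p minimize, and put p' = 1 - p,
    z = p c p' + p' c p. For K >= |c| and small e > 0 the operator
    p - e z + 2 e^2 K^2 (p' - p) still lies between 0 and 1, so minimality forces
    tau(c z) <= 0. But tau(c z) is a sum of two traces of positive operators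
    y* y, hence z = 0 by faithfulness, and c commutes with p
    (tr_minimal_commute). Next let s = |c|, which commutes with everything
    commuting with c and so lies in the double commutant M. Subtracting from p a
    small multiple of p (s + c)^2 shows (s + c) p = 0, that is c p = - |c| p
    (tr_minimal_eq_opp_abs); applied to - c and 1 - p this gives
    c (1 - p) = |c| (1 - p). With p = q^- and p = q^+ the two identities yield
    c q^- <= 0, c (1 - q^+) >= 0, and, on q^+ - q^-, both c = |c| and c = - |c|,
    whence c (q^+ - q^-) = 0 (tr_minimal_interval).

    The absolute value is the only piece of functional calculus used. For a
    self-adjoint contraction e, the limit x of x_(m+1) = (1 - e^2 + x_m^2) / 2
    satisfies 2 x = 1 - e^2 + x^2, so (1 - x)^2 = e^2. Convergence is in norm,
    with the scalar sequence r_(m+1) = (1 + r_m^2) / 2 as a majorant.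

    The equivalence is linear algebra: two hyperplanes through a common point
    coincide exactly when their normals are proportional (hyperplane_neqP). A
    supporting hyperplane may be vertical, its normal having t = 0; then the
    other one has t != 0, and adding its equation to the vertical one gives a
    supporting hyperplane of the required kind (sharp_face_spectralP). *)

(** * The underlying real inner product *)

Section RealHilbert.
Set Implicit Arguments.
Unset Strict Implicit.
Unset Printing Implicit Defensive.
Context {R : realType} {H : completeNormedModType R[i]}.
Variable dot : {dot H for Num.conj}.
Hypothesis hdot : hilbert_norm dot.

Implicit Types (x y z v w : H) (k : R).

(** Self-adjoint operators and the operator order only see the real part of the
    inner product. Passing to it makes all estimates inequalities between
    elements of a real field, where linear arithmetic applies. *)
Definition ip x y : R := complex.Re (dot x y).
Definition nm x : R := complex.Re `|x|.

Lemma dotC x y : dot x y = (dot y x)^*.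
Proof. by rewrite hermC expr0 mul1r. Qed.

Lemma ReD (z1 z2 : R[i]) : complex.Re (z1 + z2) = complex.Re z1 + complex.Re z2.
Proof. by case: z1 z2 => a b [c d]. Qed.

Lemma ReN (z1 : R[i]) : complex.Re (- z1) = - complex.Re z1.
Proof. by case: z1 => a b. Qed.

Lemma ReZ k (z1 : R[i]) : complex.Re (k%:C%C * z1) = k * complex.Re z1.
Proof. by case: z1 => a b /=; rewrite mul0r subr0. Qed.

Lemma ipC x y : ip x y = ip y x.
Proof. by rewrite /ip dotC; case: (dot y x). Qed.

Lemma ipDl x y z : ip (x + y) z = ip x z + ip y z.
Proof. by rewrite /ip linearDl ReD. Qed.

Lemma ipNl x y : ip (- x) y = - ip x y.
Proof. by rewrite /ip linearNl ReN. Qed.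

Lemma ipZl k x y : ip (k%:C%C *: x) y = k * ip x y.
Proof. by rewrite /ip linearZl_LR /= ReZ. Qed.

Lemma ipDr x y z : ip x (y + z) = ip x y + ip x z.
Proof. by rewrite ipC ipDl !(ipC _ x). Qed.

Lemma ipNr x y : ip x (- y) = - ip x y.
Proof. by rewrite ipC ipNl ipC. Qed.

Lemma ipZr k x y : ip x (k%:C%C *: y) = k * ip x y.
Proof. by rewrite ipC ipZl ipC. Qed.

Lemma normE x : `|x| = (nm x)%:C%C.
Proof. by rewrite /nm RRe_real // normr_real. Qed.

Lemma nm_ge0 x : 0 <= nm x.
Proof. by rewrite -lecR -normE normr_ge0. Qed.

Lemma ip_nm x : ip x x = nm x ^+ 2.
Proof. by rewrite /ip -hdot normE -rmorphXn. Qed.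

Lemma ip_ge0 x : 0 <= ip x x.
Proof. by rewrite ip_nm sqr_ge0. Qed.

Lemma nm_eq0 x : nm x = 0 -> x = 0.
Proof. by move=> h; apply/eqP; rewrite -normr_eq0 normE h. Qed.

Lemma ip_eq0 x : ip x x = 0 -> x = 0.
Proof. by rewrite ip_nm => /eqP; rewrite sqrf_eq0 => /eqP; exact: nm_eq0. Qed.

Lemma nm0 : nm 0 = 0.
Proof. by rewrite /nm normr0. Qed.

Lemma nmD x y : nm (x + y) <= nm x + nm y.
Proof. by rewrite -lecR rmorphD /= -!normE ler_normD. Qed.

Lemma nmN x : nm (- x) = nm x.
Proof. by rewrite /nm normrN. Qed.

Lemma nmZ k x : nm (k%:C%C *: x) = `|k| * nm x.
Proof.
apply: complexI; rewrite -normE normrZ normE rmorphM /=; congr (_ * _).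
by rewrite normc_def /= expr0n addr0 sqrtr_sqr.
Qed.

Lemma nmZC (l : R[i]) x : nm (l *: x) = complex.Re `|l| * nm x.
Proof.
by apply: complexI; rewrite rmorphM /= RRe_real ?normr_real // -!normE normrZ.
Qed.

Lemma ler_nm x y : (nm x <= nm y) = (ip x x <= ip y y).
Proof. by rewrite !ip_nm ler_pXn2r // nnegrE nm_ge0. Qed.

Lemma le_nm_ip x y k : 0 <= k -> (nm x <= k * nm y) = (ip x x <= k ^+ 2 * ip y y).
Proof.
by move=> k0; rewrite !ip_nm -exprMn ler_pXn2r // nnegrE ?mulr_ge0 ?nm_ge0.
Qed.

Lemma ip_CauchySchwarz x y : `|ip x y| <= nm x * nm y.
Proof.
have h1 k : 0 <= nm x ^+ 2 + 2 * k * ip x y + k ^+ 2 * nm y ^+ 2.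
  have := ip_ge0 (x + k%:C%C *: y).
  rewrite ipDl !ipDr !ipZl !ipZr (ipC y x) !ip_nm; lra.
have [y0|y0] := eqVneq (nm y) 0.
  by rewrite (nm_eq0 y0) nm0 mulr0 ipC /ip linear0l normr0.
have yp : 0 < nm y by rewrite lt_def y0 nm_ge0.
rewrite -ler_sqr ?nnegrE ?mulr_ge0 ?nm_ge0 // exprMn real_normK ?num_real //.
have := h1 (- ip x y / nm y ^+ 2).
have -> : nm x ^+ 2 + 2 * (- ip x y / nm y ^+ 2) * ip x y
    + (- ip x y / nm y ^+ 2) ^+ 2 * nm y ^+ 2 =
    (nm x ^+ 2 * nm y ^+ 2 - ip x y ^+ 2) / nm y ^+ 2 by field.
by rewrite pmulr_lge0 ?subr_ge0 // invr_gt0 exprn_gt0.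
Qed.

(** * Linear maps and boundedness *)

Lemma linD (a : H -> H) : linear a -> forall u v, a (u + v) = a u + a v.
Proof. by move=> la u v; rewrite -[u]scale1r la !scale1r. Qed.

Lemma lin0 (a : H -> H) : linear a -> a 0 = 0.
Proof. by move=> la; apply: (@addIr _ (a 0)); rewrite -linD // !add0r. Qed.

Lemma linZ (a : H -> H) : linear a -> forall (l : R[i]) u, a (l *: u) = l *: a u.
Proof. by move=> la l u; rewrite -[l *: u]addr0 la lin0 // !addr0. Qed.

Lemma linN (a : H -> H) : linear a -> forall u, a (- u) = - a u.
Proof. by move=> la u; rewrite -[in LHS]scaleN1r linZ // scaleN1r. Qed.

Lemma linB (a : H -> H) : linear a -> forall u v, a (u - v) = a u - a v.
Proof. by move=> la u v; rewrite linD // linN. Qed.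

Lemma bounded_nm (a : H -> H) : bounded_operator a ->
  exists2 K, 0 < K & forall v, nm (a v) <= K * nm v.
Proof.
move=> [_ [K hK]]; exists (`|K| + 1) => [|v]; first by rewrite ltr_wpDl.
have := hK v; rewrite !normE -rmorphM lecR => /le_trans; apply.
by rewrite ler_wpM2r ?nm_ge0 // ler_wpDr // ler_norm.
Qed.

Lemma nm_bounded (a : H -> H) K : linear a -> (forall v, nm (a v) <= K * nm v) ->
  bounded_operator a.
Proof.
by move=> la hK; split=> //; exists K => v; rewrite !normE -rmorphM lecR.
Qed.

Definition sym (a : H -> H) := forall x y, ip (a x) y = ip x (a y).

Lemma sa_sym (a : H -> H) : self_adjoint dot a -> sym a.
Proof. by move=> h x y; rewrite /ip h. Qed.

(** Multiplying a vector by i exchanges the two parts of the inner product; this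
    recovers the complex adjunction from the real one. *)
Lemma Im_dot x y : complex.Im (dot x y) = ip x ('i%C *: y).
Proof.
rewrite /ip (dotC x (_ *: y)) linearZl_LR /= (dotC x y).
by case: (dot y x) => a b /=; lra.
Qed.

Lemma sym_self_adjoint (a : H -> H) : linear a -> sym a -> self_adjoint dot a.
Proof.
move=> la sa x y; apply/eqP; rewrite eq_complex; apply/andP; split; apply/eqP.
  exact: sa.
by rewrite !Im_dot sa linZ.
Qed.

(** * Square roots by iteration *)

(** Approximations of the solution x of 2 x = u + x^2; for u = 1 - a^2 this is
    x = 1 - |a|. *)
Fixpoint sqrt_it (u : H -> H) (n : nat) : H -> H :=
  if n is m.+1 then
    fun v => (2^-1 : R)%:C%C *: (u v + sqrt_it u m (sqrt_it u m v))
  else fun=> 0.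

(** The same recursion for u = 1. As the approximations are polynomials in u
    with nonnegative coefficients, it dominates them, and their differences, in
    norm. *)
Fixpoint sqrt_rate (n : nat) : R :=
  if n is m.+1 then (1 + sqrt_rate m ^+ 2) / 2 else 0.

Lemma sqrt_rate_bound n : 0 <= sqrt_rate n <= 1.
Proof. elim: n => [|n /= IH]; [by rewrite /= lexx ler01 | by nra]. Qed.

Lemma sqrt_rate_mono n j : sqrt_rate n <= sqrt_rate (n + j).
Proof.
elim: n => [|n IH]; first by have /andP[] := sqrt_rate_bound j.
have /andP[h _] := sqrt_rate_bound n.
by rewrite addSn /= ler_pM2r ?invr_gt0 // lerD2l lerXn2r // nnegrE (le_trans h).
Qed.

(** The gap g = 1 - r obeys g |-> g - g^2 / 2, which is increasing on [0, 1] and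
    maps 2 / k below 2 / (k + 1). An explicit rate lets later arguments prove
    identities between limits by comparing norms, without limits. *)
Lemma sqrt_rate_gap n : 1 - sqrt_rate n <= 2 / n.+2%:R.
Proof.
elim: n => [|n IH] /=; first by rewrite subr0 divff.
have /andP[h0 h1] := sqrt_rate_bound n.
have n0 : 0 < n.+2%:R :> R by rewrite ltr0n.
set m : R := n.+2%:R in IH n0 *.
have -> : n.+3%:R = m + 1 :> R by rewrite /m -natr1.
have m2 : 2 <= m by rewrite ler_nat.
clearbody m.
set q := 2 / m in IH.
have q1 : q <= 1 by rewrite ler_pdivrMr // mul1r.
apply: (@le_trans _ _ (q - q ^+ 2 / 2)); first by nra.
have m1 : 0 < m + 1 by lra.
rewrite ler_pdivlMr // -subr_ge0.
have -> : 2 - (q - q ^+ 2 / 2) * (m + 1) = 2 / m ^+ 2.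
  by rewrite /q; field; rewrite gt_eqF.
by rewrite divr_ge0 // sqr_ge0.
Qed.

Lemma eq0_of_sqrt_rate a K :
  0 <= a -> (forall n, a <= K * (1 - sqrt_rate n)) -> a = 0.
Proof.
move=> a0 h; apply/eqP; rewrite eq_le a0 andbT leNgt; apply/negP => {}a0.
have K0 : 0 <= K.
  by have := h 0%N; rewrite /= subr0 mulr1; apply: le_trans; exact: ltW.
pose n := Num.bound (K * 2 / a).
have := archi_boundP (divr_ge0 (mulr_ge0 K0 (ler0n R 2)) (ltW a0)).
rewrite ltr_pdivrMr // -/n => h1.
have := le_trans (h n) (ler_wpM2l K0 (sqrt_rate_gap n)).
rewrite mulrA ler_pdivlMr ?ltr0n // -natr1 -natr1; nra.
Qed.

Lemma vec_eq0_of_sqrt_rate w K :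
  (forall n, nm w <= K * (1 - sqrt_rate n)) -> w = 0.
Proof. by move=> h; apply/nm_eq0/eq0_of_sqrt_rate/h/nm_ge0. Qed.

Section Iteration.
Variable u : H -> H.
Hypotheses (ul : linear u) (us : sym u) (uc : forall v, nm (u v) <= nm v).
Local Notation X := (sqrt_it u).

Lemma sqrt_it_linear n : linear (X n).
Proof.
elim: n => [|n IH] k v w /=; first by rewrite scaler0 addr0.
by rewrite ul !IH !scalerDr !scalerA ![k * _]mulrC -!scalerA addrACA.
Qed.

Lemma sqrt_it_sym n : sym (X n).
Proof.
elim: n => [|n IH] x y /=; first by rewrite /ip linear0l linear0r.
by rewrite ipZl ipZr ipDl ipDr us !IH.
Qed.

Lemma sqrt_it_comm d n : linear d -> (forall v, d (u v) = u (d v)) ->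
  forall v, d (X n v) = X n (d v).
Proof.
move=> dl du; elim: n => [|n IH] v /=; first exact: lin0.
by rewrite linZ // linD // du !IH.
Qed.

Lemma sqrt_it_nm n v : nm (X n v) <= sqrt_rate n * nm v.
Proof.
elim: n v => [|n IH] v /=; first by rewrite nm0 mul0r.
rewrite nmZ ger0_norm ?invr_ge0 // mulrC ler_pdivrMr //.
apply: (le_trans (nmD _ _)); have /andP[r0 _] := sqrt_rate_bound n.
apply: (le_trans (lerD (uc v) (le_trans (IH _) (ler_wpM2l r0 (IH v))))).
by have := nm_ge0 v; lra.
Qed.

(** Induction on n alone, through a^2 - c^2 = a (a - c) + (a - c) c, which holds
    without commutation; the scalar bounds multiply out to r_m^2 - r_n^2. *)
Lemma sqrt_it_cauchy n j v :
  nm (X (n + j)%N v - X n v) <= (sqrt_rate (n + j) - sqrt_rate n) * nm v.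
Proof.
elim: n v => [|n IH] v; first by rewrite !subr0 sqrt_it_nm.
rewrite addSn /= -scalerBr nmZ ger0_norm ?invr_ge0 // mulrC ler_pdivrMr //.
rewrite opprD addrACA subrr add0r.
have h3 : 0 <= sqrt_rate (n + j) - sqrt_rate n by rewrite subr_ge0 sqrt_rate_mono.
set m := (n + j)%N in IH h3 *.
have -> : X m (X m v) - X n (X n v)
    = X m (X m v - X n v) + (X m (X n v) - X n (X n v)).
  by rewrite (linB (sqrt_it_linear m)) addrA subrK.
have /andP[r0 _] := sqrt_rate_bound n; have /andP[r1 _] := sqrt_rate_bound m.
apply: (le_trans (nmD _ _)).
have h1 := le_trans (sqrt_it_nm m _) (ler_wpM2l r1 (IH v)).
have h4 := le_trans (IH (X n v)) (ler_wpM2l h3 (sqrt_it_nm n v)).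
by apply: (le_trans (lerD h1 h4)); lra.
Qed.

(** The bound by 1 - sqrt_rate n instead of a mere convergence statement is what
    the uniqueness arguments for the limit operator consume. *)
Lemma sqrt_it_lim v :
  exists L, forall n, nm (L - X n v) <= (1 - sqrt_rate n) * nm v.
Proof.
have bnd n j : nm (X (n + j)%N v - X n v) <= (1 - sqrt_rate n) * nm v.
  apply: (le_trans (sqrt_it_cauchy n j v)); rewrite ler_wpM2r ?nm_ge0 // lerB //.
  by have /andP[] := sqrt_rate_bound (n + j).
have cv : cvg (X n v @[n --> \oo]).
  apply: cauchy_cvg; apply/cauchy_exP => e e0.
  have [r er] : exists r : R, e = r%:C%C by apply/complex_realP/gtr0_real.
  have r0 : 0 < r by rewrite -ltcR -er.
  have [N hN] : exists N, (1 - sqrt_rate N) * nm v < r.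
    apply: contrapT => /forallNP h.
    have v0 : v = 0.
      apply: (@vec_eq0_of_sqrt_rate _ (nm v ^+ 2 / r)) => N.
      have /negP := h N; rewrite -leNgt => {}h.
      rewrite mulrAC ler_pdivlMr // expr2 -mulrA ler_wpM2l ?nm_ge0 // mulrC //.
    by apply: (h 0%N); rewrite v0 nm0 mulr0.
  exists (X N v), N => // m /= Nm.
  rewrite -ball_normE /= distrC -(subnKC Nm) normE er ltcR.
  exact: le_lt_trans (bnd _ _) hN.
exists (lim (X n v @[n --> \oo])) => n.
apply/ler_addgt0Pr => e e0.
have ec : 0 < e%:C%C :> R[i] by rewrite ltcR.
have /cvgrPdist_lt /(_ _ ec) [N _ hN] := cv.
have := hN (n + N)%N (leq_addl _ _) => /=; rewrite normE ltcR => h.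
have := nmD (lim (X n v @[n --> \oo]) - X (n + N)%N v) (X (n + N)%N v - X n v).
rewrite addrA subrK => /le_trans; apply.
by rewrite addrC lerD // ltW.
Qed.

(** Each property of the limit operator holds up to a multiple of
    1 - sqrt_rate n for the n-th approximation, hence exactly. Commutation
    passes to the limit because the commuting operator is bounded. *)
Lemma ex_half_square_fixpoint : exists x : H -> H,
  [/\ linear x, sym x, (forall v, nm (x v) <= nm v),
      (forall v, x v + x v = u v + x (x v)) &
      forall d, bounded_operator d -> (forall v, d (u v) = u (d v)) ->
        forall v, d (x v) = x (d v)].
Proof.
have [x hx] := choice sqrt_it_lim.
have close y v : (exists K, forall n, nm (y - X n v) <= K * (1 - sqrt_rate n)) ->
    x v = y.
  move=> [K hK]; apply/subr0_eq/(@vec_eq0_of_sqrt_rate _ (nm v + K)) => n.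
  have := nmD (x v - X n v) (X n v - y); rewrite addrA subrK => /le_trans; apply.
  rewrite -(nmN (X n v - y)) opprB mulrDl lerD // mulrC; exact: hx.
have xlin : linear x.
  move=> k v w; apply: close.
  have [r kr] : exists r, `|k| = r%:C%C by apply/complex_realP/normr_real.
  exists (r * nm v + nm w) => n.
  rewrite (sqrt_it_linear n) opprD addrACA -scalerBr.
  apply: (le_trans (nmD _ _)).
  have -> : nm (k *: (x v - X n v)) = r * nm (x v - X n v).
    by apply: complexI; rewrite -normE normrZ kr normE rmorphM.
  have r0 : 0 <= r by rewrite -lecR -kr normr_ge0.
  by have := ler_wpM2l r0 (hx v n); have := hx w n; lra.
have xsym : sym x.
  move=> v w; apply/eqP; rewrite -subr_eq0 -normr_eq0; apply/eqP.
  apply: (@eq0_of_sqrt_rate _ (2 * nm v * nm w)) => // n.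
  have -> : ip (x v) w - ip v (x w) = ip (x v - X n v) w - ip v (x w - X n w).
    by rewrite ipDl ipDr ipNl ipNr sqrt_it_sym; ring.
  apply: (le_trans (ler_normB _ _)).
  have h1 := le_trans (ip_CauchySchwarz _ w) (ler_wpM2r (nm_ge0 w) (hx v n)).
  have h2 := le_trans (ip_CauchySchwarz v _) (ler_wpM2l (nm_ge0 v) (hx w n)).
  by lra.
have xnm v : nm (x v) <= nm v.
  by have := hx v 0%N; rewrite /= !subr0 mul1r.
exists x; split => //.
- move=> v; apply/subr0_eq/(@vec_eq0_of_sqrt_rate _ (4 * nm v)) => n.
  have twice : X n.+1 v + X n.+1 v = u v + X n (X n v).
    rewrite /= -scalerDl -rmorphD.
    by have -> : 2^-1 + 2^-1 = 1 :> R; [lra | rewrite scale1r].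
  have -> : x v + x v - (u v + x (x v)) = (x v - X n.+1 v) + (x v - X n.+1 v)
      - ((x (x v) - X n (x v)) + X n (x v - X n v)).
    rewrite (linB (sqrt_it_linear n)).
    have -> : x (x v) - X n (x v) + (X n (x v) - X n (X n v))
        = x (x v) - X n (X n v) by rewrite addrA subrK.
    rewrite  [X in _ = X - _]addrACA -opprD twice -[RHS]addrA -opprD; congr (_ - _).
    by rewrite -addrA [X n _ + _]addrC subrK.
  have /andP[r0 r1] := sqrt_rate_bound n.
  have mono := sqrt_rate_mono n 1; rewrite addn1 in mono.
  have h1 := le_trans (hx v n.+1) (ler_wpM2r (nm_ge0 v) (lerB (lexx 1) mono)).
  have s0 : 0 <= 1 - sqrt_rate n by rewrite subr_ge0.
  have h2 := le_trans (hx (x v) n) (ler_wpM2l s0 (xnm v)).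
  have h3 := le_trans (sqrt_it_nm n _) (le_trans (ler_wpM2l r0 (hx v n))
    (ler_piMl (mulr_ge0 s0 (nm_ge0 v)) r1)).
  have h4 := nmD (x v - X n.+1 v) (x v - X n.+1 v).
  have h5 := nmD (x (x v) - X n (x v)) (X n (x v - X n v)).
  by apply: (le_trans (nmD _ _)); rewrite nmN; lra.
- move=> d db du v; apply/esym/close.
  have [K K0 hK] := bounded_nm db; exists (K * nm v) => n.
  have dl := db.1.
  rewrite -(sqrt_it_comm n dl du) -(linB dl) (le_trans (hK _)) //.
  by have := ler_wpM2l (ltW K0) (hx v n); lra.
Qed.
End Iteration.
(** The absolute value s of c. After scaling c to a contraction e, the operator
    1 - e^2 is again a contraction, and s = K (1 - x) for the fixed point x. Its
    positivity comes from x being a contraction. The last clause places s in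
    every von Neumann algebra containing c. *)
Lemma abs_exists (c : H -> H) : bounded_operator c -> self_adjoint dot c ->
  exists s : H -> H,
  [/\ bounded_operator s, self_adjoint dot s, forall v, 0 <= ip (s v) v,
      s \o s = c \o c &
      forall d, bounded_operator d -> d \o c = c \o d -> d \o s = s \o d].
Proof.
move=> bc sc; have [K K0 cK] := bounded_nm bc; have cl := bc.1.
have cs := sa_sym sc.
have KV : 0 < K^-1 by rewrite invr_gt0.
pose e v := (K^-1)%:C%C *: c v.
have el : linear e by move=> k u v; rewrite /e cl scalerDr !scalerA mulrC.
have es : sym e by move=> x y; rewrite ipZl ipZr cs.
have en v : nm (e v) <= nm v.
  by rewrite nmZ gtr0_norm // mulrC ler_pdivrMr // mulrC.
pose u v := v - e (e v).
have ul : linear u.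
  by move=> k v w; rewrite /u !el scalerBr opprD addrACA.
have us : sym u by move=> x y; rewrite !(ipDl, ipDr, ipNl, ipNr) !es.
have un v : nm (u v) <= nm v.
  have h0 := en v; have h1 := en (e v); rewrite !ler_nm in h0 h1 *.
  rewrite !(ipDl, ipDr, ipNl, ipNr) (ipC v (e _)) !(es (e v) v).
  by have := ip_ge0 (e v); lra.
have [x [xl xs xn xE xcomm]] := ex_half_square_fixpoint ul us un.
exists (fun v => K%:C%C *: (v - x v)).
have Kne : K%:C%C != 0 :> R[i] by rewrite (inj_eq (@complexI _)) gt_eqF.
have sl : linear (fun v => K%:C%C *: (v - x v)).
  move=> k v w; rewrite xl opprD addrACA -scalerBr scalerDr !scalerA.
  by rewrite mulrC.
have ce v : c v = K%:C%C *: e v.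
  by rewrite /e scalerA -rmorphM /= divff ?gt_eqF // scale1r.
split.
- apply: (@nm_bounded _ (K * 2)) => // v; rewrite nmZ gtr0_norm // -mulrA.
  rewrite ler_wpM2l ?(ltW K0) // (le_trans (nmD _ _)) // nmN.
  by have := xn v; lra.
- apply: sym_self_adjoint => // v w.
  by rewrite ipZl ipZr !(ipDl, ipDr, ipNl, ipNr) xs; lra.
- move=> v; rewrite ipZl ipDl ipNl mulr_ge0 ?(ltW K0) // subr_ge0.
  rewrite (ip_nm v); have := ip_CauchySchwarz (x v) v => /ler_normlP [_].
  by move=> /le_trans; apply; rewrite expr2 ler_wpM2r ?nm_ge0.
- apply/funext => v /=; rewrite (linZ xl) !ce (linZ el) -scalerBr.
  congr (_ *: (_ *: _)).
  have -> : v - x v - x (v - x v) = v - u v.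
    rewrite (linB xl) opprB addrACA -opprD xE opprD addrACA subrr addr0 //.
  by rewrite /u opprB addrC subrK.
- move=> d bd dc; have dl := bd.1; apply/funext => v /=.
  rewrite (linZ dl) (linB dl) xcomm // => w.
  have de z : d (e z) = e (d z).
    by rewrite /e (linZ dl); congr (_ *: _); exact: (congr1 (fun f => f z) dc).
  by rewrite /u (linB dl) !de.
Qed.

(** * Self-adjoint operators, the order and projections *)

Lemma comp_at (a c a' c' : H -> H) :
  a \o c = a' \o c' -> forall v, a (c v) = a' (c' v).
Proof. by move=> /funeqP. Qed.

Lemma sa0 : self_adjoint dot 0.
Proof. by move=> x y; rewrite linear0l linear0r. Qed.

Lemma saD (a c : H -> H) : self_adjoint dot a -> self_adjoint dot c ->
  self_adjoint dot (a + c).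
Proof. by move=> ha hc x y; rewrite !fctE linearDl linearDr /= ha hc. Qed.

Lemma saZ k (a : H -> H) : self_adjoint dot a -> self_adjoint dot (k%:C%C *: a).
Proof.
move=> ha x y; rewrite linearZl_LR linearZr_LR /= ha; congr (_ * _).
by apply/eqP; rewrite eq_complex /= oppr0 !eqxx.
Qed.

Lemma saN (a : H -> H) : self_adjoint dot a -> self_adjoint dot (- a).
Proof. by move=> ha x y; rewrite !fctE linearNl linearNr /= ha. Qed.

Lemma saB (a c : H -> H) : self_adjoint dot a -> self_adjoint dot c ->
  self_adjoint dot (a - c).
Proof. by move=> ha hc; exact: saD ha (saN hc). Qed.

Lemma sa_comp (a c : H -> H) : self_adjoint dot a -> self_adjoint dot c ->
  a \o c = c \o a -> self_adjoint dot (a \o c).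
Proof. by move=> ha hc ac x y; rewrite /= ha hc (comp_at ac). Qed.

(** For self-adjoint operators the inner product defining the order is
    automatically real. *)
Lemma ople_ip (a c : H -> H) : self_adjoint dot a -> self_adjoint dot c ->
  (forall v, ip (a v) v <= ip (c v) v) -> ople dot a c.
Proof.
move=> sa sc h v; rewrite lecE; apply/andP; split.
  have := dotC ((c - a) v) v; rewrite -(saB sc sa).
  by case: (dot _ _) => r i /= [] ii; apply/eqP; lra.
by rewrite -/(ip _ _) ipDl ipNl subr_ge0.
Qed.

Lemma ip_ople (a c : H -> H) : ople dot a c -> forall v, ip (a v) v <= ip (c v) v.
Proof.
move=> h v; have := h v; rewrite lecE => /andP[_].
by rewrite -/(ip _ _) ipDl ipNl subr_ge0.
Qed.

Lemma ople_gram (a a' : H -> H) : adjoint dot a a' -> ople dot 0 (a' \o a).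
Proof.
move=> h v; rewrite subr0 /= dotC -h conj_ge0; exact: dnorm_ge0.
Qed.

(** Together with ople_gram and faithfulness this turns a vanishing trace
    tau(a* a) into a = 0. *)
Lemma gram_eq0 (a a' : H -> H) : adjoint dot a a' -> a' \o a = 0 -> a = 0.
Proof.
move=> h a0; apply/funext => v; apply: ip_eq0.
by rewrite /ip h (congr1 (fun f => f v) a0 : a' (a v) = 0) linear0r.
Qed.

Lemma ip_projection (p : H -> H) v : projection dot p ->
  ip (p v) v = ip (p v) (p v).
Proof. by move=> [pp sp]; rewrite -{1}(comp_at pp) (sa_sym sp). Qed.

Lemma ip_projection_le (p : H -> H) v : projection dot p ->
  ip (p v) (p v) <= ip v v.
Proof.
move=> hp; have := ip_ge0 (v - p v).
by rewrite !(ipDl, ipDr, ipNl, ipNr) (ipC v) (ip_projection _ hp); lra.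
Qed.

Lemma projection_compl (p : H -> H) : linear p -> projection dot p ->
  projection dot (idfun - p).
Proof.
move=> pl [pp sp]; split; last exact: saB.
by apply/funext => v; rewrite /= !fctE /= (linB pl) (comp_at pp) subrr subr0.
Qed.

(** * The algebra and its trace *)

Section VN.
Variable M : set (H -> H).
Hypothesis hM : von_neumann_algebra dot M.

Lemma vN_bounded a : M a -> bounded_operator a.
Proof. by rewrite -hM.2 => -[]. Qed.

Lemma vN_linear a : M a -> linear a.
Proof. by case/vN_bounded. Qed.

(** The double commutant property as a membership test: closure of M under the
    algebra operations and membership of |c| both go through it. *)
Lemma vN_intro a : bounded_operator a ->
  (forall d, bounded_operator d -> (forall c, M c -> d \o c = c \o d) ->
    d \o a = a \o d) -> M a.
Proof. by move=> ba h; rewrite -hM.2; split=> // d [bd dc]; rewrite -h. Qed.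

Lemma vN_id : M idfun.
Proof.
apply: vN_intro => //; split; first by move=> k u v.
by exists 1 => v; rewrite mul1r.
Qed.

Lemma vN_comp a c : M a -> M c -> M (a \o c).
Proof.
move=> Ma Mc; have [la [ka ha]] := vN_bounded Ma; have [lc _] := vN_bounded Mc.
have [K K0 aK] := bounded_nm (vN_bounded Ma).
have [L L0 cL] := bounded_nm (vN_bounded Mc).
apply: vN_intro => [|d bd dc].
  apply: (@nm_bounded _ (K * L)) => [k u v|v] /=; first by rewrite lc la.
  by rewrite (le_trans (aK _)) // -mulrA ler_wpM2l ?(ltW K0).
by rewrite compA (dc _ Ma) -compA (dc _ Mc).
Qed.

Lemma vN_lin_comb2 (k : R[i]) a c : M a -> M c -> M (k *: a + c).
Proof.
move=> Ma Mc; have [la [ka ha]] := vN_bounded Ma; have [lc _] := vN_bounded Mc.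
have [K K0 aK] := bounded_nm (vN_bounded Ma).
have [L L0 cL] := bounded_nm (vN_bounded Mc).
have kl : linear (k *: a + c).
  move=> l u v; rewrite !fctE /= la lc !scalerDr !scalerA [k * _]mulrC.
  by rewrite -!addrA; congr (_ + _); rewrite addrCA.
apply: vN_intro => [|d bd dc].
  apply: (@nm_bounded _ (complex.Re `|k| * K + L)) => // v.
  rewrite !fctE (le_trans (nmD _ _)) // nmZC mulrDl lerD // -mulrA.
  by rewrite ler_wpM2l // -lecR RRe_real ?normr_real ?normr_ge0.
apply/funext => v; rewrite /= !fctE (linD bd.1) (linZ bd.1).
by rewrite (comp_at (dc _ Ma)) (comp_at (dc _ Mc)).
Qed.

Lemma vN0 : M 0.
Proof.
have -> : 0 = (-1) *: idfun + idfun :> (H -> H).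
  by apply/funext => v; rewrite !fctE /= scaleN1r addNr.
by apply: vN_lin_comb2; exact: vN_id.
Qed.

Lemma vND a c : M a -> M c -> M (a + c).
Proof. by move=> Ma Mc; rewrite -[a]scale1r; exact: vN_lin_comb2. Qed.

Lemma vNZ (k : R[i]) a : M a -> M (k *: a).
Proof. by move=> Ma; rewrite -[k *: a]addr0; apply: vN_lin_comb2 => //; exact: vN0. Qed.

Lemma vNB a c : M a -> M c -> M (a - c).
Proof. by move=> Ma Mc; rewrite -scaleN1r addrC; exact: vN_lin_comb2. Qed.

Variable tau : (H -> H) -> R[i].
Hypothesis htau : faithful_normal_tracial_state dot M tau.

Definition tr a : R := complex.Re (tau a).

Lemma tau0 : tau 0 = 0.
Proof.
have := state_linear htau 1 vN0 vN0; rewrite scaler0 addr0 mul1r => h.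
by apply: (@addrI _ (tau 0)); rewrite addr0 -h.
Qed.

Lemma trD a c : M a -> M c -> tr (a + c) = tr a + tr c.
Proof.
by move=> Ma Mc; rewrite /tr -[a]scale1r (state_linear htau) // mul1r scale1r ReD.
Qed.

Lemma trZ k a : M a -> tr (k%:C%C *: a) = k * tr a.
Proof.
move=> Ma; rewrite /tr -[_ *: a]addr0 (state_linear htau) //; last exact: vN0.
by rewrite tau0 addr0 ReZ.
Qed.

Lemma trN a : M a -> tr (- a) = - tr a.
Proof.
move=> Ma; rewrite -scaleN1r.
have -> : -1 = (-1 : R)%:C%C by rewrite rmorphN.
by rewrite trZ // mulN1r.
Qed.

Lemma trB a c : M a -> M c -> tr (a - c) = tr a - tr c.
Proof.
by move=> Ma Mc; rewrite trD ?trN // -scaleN1r; exact: vNZ.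
Qed.

Lemma trC a c : M a -> M c -> tr (a \o c) = tr (c \o a).
Proof. by move=> Ma Mc; rewrite /tr (state_trace htau). Qed.

Lemma tr_ge0 a : M a -> ople dot 0 a -> 0 <= tr a.
Proof. by move=> Ma a0; have := state_ge0 htau Ma a0; rewrite lecE => /andP[]. Qed.

Lemma tr_le0_eq0 a : M a -> ople dot 0 a -> tr a <= 0 -> a = 0.
Proof.
move=> Ma a0 ta; apply: (state_faithful htau) => //.
have t0 := state_ge0 htau Ma a0.
apply/eqP; rewrite eq_complex (ger0_Im t0) eqxx andbT eq_le ta.
exact: tr_ge0.
Qed.

(** * Optimality conditions for minimizing projections *)

Definition tr_minimal c p :=
  forall a, op_unit_interval dot M a -> tr (c \o p) <= tr (c \o a).

(** First-order condition in the off-diagonal directions. Rotating p by a small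
    angle would be the natural variation; adding a quadratic correction
    2 e^2 K^2 (p' - p) to p - e z achieves the same and keeps the operator in
    the unit interval by completing a square. *)
Lemma tr_minimal_commute c p : M c -> self_adjoint dot c ->
  M p -> projection dot p -> tr_minimal c p -> c \o p = p \o c.
Proof.
move=> Mc sc Mp hp cmin.
have cl := vN_linear Mc; have pl := vN_linear Mp.
pose p' : H -> H := idfun - p.
have Mp' : M p' by apply: vNB => //; exact: vN_id.
have hp' : projection dot p' by exact: projection_compl.
have [pp sp] := hp; have [pp' sp'] := hp'.
have ppv v : p (p v) = p v by exact: comp_at pp v.
have ppv' v : p' (p' v) = p' v by exact: comp_at pp' v.
have p'E v : p' v = v - p v by [].
have splitv v : v = p v + p' v by rewrite p'E addrC subrK.
clearbody p'.
pose y := p \o (c \o p'); pose y' := p' \o (c \o p).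
have My : M y by do 2!apply: vN_comp => //.
have My' : M y' by do 2!apply: vN_comp => //.
have yadj : adjoint dot y y' by move=> u v; rewrite /= sp sc sp'.
have yadj' : adjoint dot y' y by move=> u v; rewrite /= sp' sc sp.
have [K K0 cK] := bounded_nm (vN_bounded Mc).
have cK2 v : ip (c v) (c v) <= K ^+ 2 * ip v v by rewrite -le_nm_ip // ltW.
have Myy : M (y' \o y) by exact: vN_comp.
have Myy' : M (y \o y') by exact: vN_comp.
have Mcy : M (c \o y) by exact: vN_comp.
have Mcy' : M (c \o y') by exact: vN_comp.
(* Idempotence and the trace property: tau(c p c p') = tau(p' c p p c p'). *)
have ty : tr (c \o y) = tr (y' \o y).
  have -> : c \o y = (c \o p \o c \o p') \o p'.
    by apply/funext => v; rewrite /= ppv'.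
  rewrite trC //.
  by congr tr; apply/funext => v; rewrite /y /y' /= ppv.
have ty' : tr (c \o y') = tr (y \o y').
  have -> : c \o y' = (c \o p' \o c \o p) \o p.
    by apply/funext => v; rewrite /= ppv.
  rewrite trC //.
  by congr tr; apply/funext => v; rewrite /y /y' /= ppv'.
have ty0 : 0 <= tr (y' \o y) by apply: tr_ge0 => //; exact: ople_gram.
have ty0' : 0 <= tr (y \o y') by apply: tr_ge0 => //; exact: ople_gram.
pose D := K ^+ 2 * tr (c \o (p' - p)).
have Md : M (p' - p) by exact: vNB.
have Mz : M (y + y') by exact: vND.
have key e : 0 < e -> 4 * e ^+ 2 * K ^+ 2 <= 1 ->
    tr (y' \o y) + tr (y \o y') <= 2 * e * D.
  move=> e0 eK.
  (* The coefficient 2 e^2 K^2 is what the two squares cP and cQ below require;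
     the bound on e keeps it at most 1/2. *)
  pose a := p + ((- e)%:C%C *: (y + y') + (2 * e ^+ 2 * K ^+ 2)%:C%C *: (p' - p)).
  have Ma : M a by apply: vND => //; apply: vN_lin_comb2 => //; exact: vNZ.
  have aE v : ip (a v) v = ip (p v) (p v) - 2 * e * ip (c (p' v)) (p v)
      + 2 * e ^+ 2 * K ^+ 2 * (ip (p' v) (p' v) - ip (p v) (p v)).
    have -> : a v = p v + ((- e)%:C%C *: (y v + y' v)
      + (2 * e ^+ 2 * K ^+ 2)%:C%C *: (p' v - p v)) by [].
    have yv : ip (y v) v = ip (c (p' v)) (p v) by rewrite [LHS](sa_sym sp).
    have yv' : ip (y' v) v = ip (c (p' v)) (p v).
      by rewrite [LHS](sa_sym sp') /= ipC -(sa_sym sc).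
    rewrite !(ipDl, ipZl, ipNl) yv yv' (ip_projection v hp) (ip_projection v hp').
    by ring.
  have sa : self_adjoint dot a.
    apply: (saD sp); apply: saD; apply: saZ; last exact: saB.
    by move=> u v; rewrite !fctE linearDl linearDr /= yadj yadj' addrC.
  have vE v : ip v v = ip (p v) (p v) + ip (p' v) (p' v).
    have cross : ip (p v) (p' v) = 0.
      by rewrite (sa_sym sp) p'E (linB pl) ppv subrr ipC /ip linear0l.
    by rewrite {1 2}(splitv v) !(ipDl, ipDr) (ipC (p' v) (p v)) cross; ring.
  have cP v := ip_ge0 (p v - (2 * e)%:C%C *: c (p' v)).
  have cQ v := ip_ge0 (p' v + (2 * e)%:C%C *: c (p v)).
  have au : op_unit_interval dot M a.
    split=> //; apply: ople_ip => //; try exact: sa0.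
    - move=> v; rewrite aE {1}/ip linear0l /=.
      have := cP v; rewrite !(ipDl, ipDr, ipZl, ipZr, ipNl, ipNr).
      rewrite (ipC (p v) (c (p' v))).
      have e2 : 0 <= 2 * e ^+ 2 by rewrite mulr_ge0 ?sqr_ge0.
      have := ler_wpM2l e2 (cK2 (p' v)).
      have := ler_wpM2r (ip_ge0 (p v)) eK; lra.
    - move=> v; rewrite aE [leRHS](vE v).
      have := cQ v; rewrite !(ipDl, ipDr, ipZl, ipZr, ipNl, ipNr).
      have -> : ip (c (p v)) (p' v) = ip (c (p' v)) (p v) by rewrite (sa_sym sc) ipC.
      have -> : ip (p' v) (c (p v)) = ip (c (p' v)) (p v) by rewrite (sa_sym sc).
      have e2 : 0 <= 2 * e ^+ 2 by rewrite mulr_ge0 ?sqr_ge0.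
      have := ler_wpM2l e2 (cK2 (p v)).
      have := ler_wpM2r (ip_ge0 (p' v)) eK; lra.
  have := cmin _ au.
  have -> : c \o a = (c \o p) + ((- e)%:C%C *: ((c \o y) + (c \o y'))
      + (2 * e ^+ 2 * K ^+ 2)%:C%C *: (c \o (p' - p))).
    apply/funext => v; rewrite /a !fctE /=.
    by rewrite !(linD cl, linZ cl).
  have M1 : M (c \o p) by exact: vN_comp.
  have M2 : M ((c \o y) + (c \o y')) by exact: vND.
  have M3 : M (c \o (p' - p)) by exact: vN_comp.
  have M4 : M ((2 * e ^+ 2 * K ^+ 2)%:C%C *: (c \o (p' - p))) by exact: vNZ.
  have M5 : M ((- e)%:C%C *: ((c \o y) + (c \o y'))) by exact: vNZ.
  have M6 := vND M5 M4.
  rewrite !(trD, trZ) // ty ty' /D => h.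
  by rewrite -(ler_pM2l e0); lra.
have T0 : tr (y' \o y) + tr (y \o y') <= 0.
  set T := (X in X <= 0) in key *; rewrite leNgt; apply/negP => T0.
  have D0 : 0 < `|D| + 1 by rewrite ltr_wpDl.
  (* e = 1 / (2 K + q) is small enough for the constraint 2 e K <= 1 and for
     2 e |D| < T. *)
  pose q := 2 * (`|D| + 1) / T.
  have q0 : 0 < q by rewrite divr_gt0 // mulr_gt0.
  pose e := (2 * K + q)^-1.
  have B0 : 0 < 2 * K + q by rewrite addr_gt0 // mulr_gt0.
  have e0 : 0 < e by rewrite invr_gt0.
  have eB : e * (2 * K + q) = 1 by rewrite mulVf ?gt_eqF.
  have qT : q * T = 2 * (`|D| + 1) by rewrite divfK ?gt_eqF.
  have eK0 : 0 <= e * K by rewrite ltW ?mulr_gt0.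
  have eq0 : 0 < e * q by rewrite mulr_gt0.
  have /(key _ e0) : 4 * e ^+ 2 * K ^+ 2 <= 1.
    have -> : 4 * e ^+ 2 * K ^+ 2 = (2 * (e * K)) ^+ 2 by ring.
    by rewrite expr_le1 ?mulr_ge0 //; lra.
  have TE : T = 2 * (e * K) * T + 2 * (e * (`|D| + 1)).
    rewrite -[LHS]mul1r -{1}eB.
    have -> : e * (2 * K + q) * T = 2 * (e * K) * T + e * (q * T) by ring.
    by rewrite qT; ring.
  have := mulr_ge0 eK0 (ltW T0); have := ler_wpM2l (ltW e0) (ler_norm D).
  by rewrite -/T; lra.
have yy0 : y = 0.
  apply: (gram_eq0 yadj); apply: tr_le0_eq0 => //; [exact: ople_gram|lra].
have yy0' : y' = 0.
  apply: (gram_eq0 yadj'); apply: tr_le0_eq0 => //; [exact: ople_gram|lra].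
apply/funext => v /=.
have h1 : p (c (p' v)) = 0 := congr1 (fun f => f v) yy0.
have h2 : p' (c (p v)) = 0 := congr1 (fun f => f v) yy0'.
rewrite [in RHS](splitv v) (linD cl) (linD pl) h1 addr0.
by apply: subr0_eq; rewrite -p'E.
Qed.

(** If p minimizes, so that p commutes with c and s = |c|, then removing from p
    a small positive operator x below p cannot decrease the trace: tau(c x) <= 0.
    With w = s + c, twice the positive part of c, and g = w p, take x to be a
    multiple of g^2. As c w = s w, the operator c g^2 = g s g is positive, so it
    vanishes, and so does g. *)
Lemma tr_minimal_eq_opp_abs c s p : M c -> self_adjoint dot c ->
  M s -> self_adjoint dot s -> (forall v, 0 <= ip (s v) v) ->
  s \o s = c \o c -> c \o s = s \o c -> p \o s = s \o p -> c \o p = p \o c ->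
  M p -> projection dot p -> tr_minimal c p ->
  forall v, c (p v) = - s (p v).
Proof.
move=> Mc sc Ms ss s0 sscc cscomm pscomm pccomm Mp hp cmin.
have [pp sp] := hp.
have cl := vN_linear Mc; have pl := vN_linear Mp; have sl := vN_linear Ms.
have ppv v : p (p v) = p v by exact: comp_at pp v.
pose w := s + c; have Mw : M w by exact: vND.
have wl := vN_linear Mw.
have wE v : w v = s v + c v by [].
have sw : self_adjoint dot w by exact: saD.
have wp v : w (p v) = p (w v).
  by rewrite !wE (linD pl) (comp_at pscomm) (comp_at pccomm).
have cw v : c (w v) = s (w v).
  by rewrite wE (linD cl) (linD sl) (comp_at cscomm) (comp_at sscc) addrC.
have ws v : w (s v) = s (w v) by rewrite !wE (linD sl) (comp_at cscomm).
clearbody w.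
pose g := w \o p; have Mg : M g by exact: vN_comp.
have gE v : g v = w (p v) by [].
have sg : self_adjoint dot g by apply: sa_comp => //; apply/funext => v; exact: wp.
have gs v : g (s v) = s (g v) by rewrite !gE (comp_at pscomm) ws.
have cg v : c (g v) = s (g v) by rewrite gE cw.
have pg v : g (p v) = g v by rewrite gE ppv.
have gsym := sa_sym sg.
have [K K0 gK] := bounded_nm (vN_bounded Mg).
have Mgg : M (g \o g) by exact: vN_comp.
have gcg : g \o (s \o g) = c \o (g \o g).
  by apply/funext => v /=; rewrite gs cg.
have K2 : 0 < K ^+ 2 by rewrite exprn_gt0.
(* K bounds the norm of g, so K^-2 g^2 <= p. *)
pose a := p - (K ^- 2)%:C%C *: (g \o g).
have Ma : M a by apply: vNB => //; exact: vNZ.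
have aE v : ip (a v) v = ip (p v) (p v) - K ^- 2 * ip (g v) (g v).
  have -> : a v = p v - (K ^- 2)%:C%C *: g (g v) by [].
  by rewrite ipDl ipNl ipZl gsym (ip_projection v hp).
have gp v : K ^- 2 * ip (g v) (g v) <= ip (p v) (p v).
  by rewrite mulrC ler_pdivrMr // mulrC -[g v]pg -le_nm_ip ?(ltW K0).
have sa : self_adjoint dot a.
  by apply: (saB sp); apply: saZ; exact: sa_comp.
have gg0 : tr (c \o (g \o g)) <= 0.
  have au : op_unit_interval dot M a.
    split=> //; apply: ople_ip => //; try exact: sa0.
    - by move=> v; rewrite {1}/ip linear0l /= aE subr_ge0.
    - move=> v; rewrite aE /=.
      apply: le_trans (ip_projection_le v hp); rewrite gerBl mulr_ge0 ?ip_ge0 //.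
      by rewrite invr_ge0 ltW.
  have := cmin _ au.
  have -> : c \o a = (c \o p) - (K ^- 2)%:C%C *: (c \o (g \o g)).
    by apply/funext => v; rewrite /a !fctE /= (linB cl) (linZ cl).
  have M1 : M (c \o p) by exact: vN_comp.
  have M2 : M (c \o (g \o g)) by exact: vN_comp.
  have M3 := vNZ (K ^- 2)%:C%C M2.
  by rewrite trB // trZ // lerDl oppr_ge0 pmulr_rle0 // invr_gt0.
(* g s g is positive and has nonpositive trace. *)
have ggg0 v : c (g (g v)) = 0.
  apply: (congr1 (fun f : H -> H => f v) (_ : c \o (g \o g) = 0)).
  apply: tr_le0_eq0 => //; first exact: vN_comp.
  rewrite -gcg; apply: ople_ip; first exact: sa0.
  - by move=> x y; rewrite /= sg ss sg.
  - by move=> x; rewrite {1}/ip linear0l /= gsym.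
have g3 v : g (g (g v)) = 0.
  have pgl v' : p (g v') = g v' by rewrite gE -wp ppv.
  by rewrite [LHS]gE pgl wE -cg ggg0 addr0.
have g2 v : g (g v) = 0 by apply: ip_eq0; rewrite gsym g3 /ip linear0r.
have g1 v : g v = 0 by apply: ip_eq0; rewrite gsym g2 /ip linear0r.
move=> v; apply/eqP; rewrite -addr_eq0 addrC -wE -gE g1 //.
Qed.

(** The identity on the complement of p is the previous one for - c and 1 - p,
    since a |-> 1 - a exchanges minimizers of c and of - c. One operator s
    serves all minimizing projections, which is needed to compare two of them. *)
Lemma ex_abs_tr_minimal c : M c -> self_adjoint dot c ->
  exists s : H -> H, [/\ M s, self_adjoint dot s, forall v, 0 <= ip (s v) v &
    forall p, M p -> projection dot p -> tr_minimal c p ->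
      [/\ c \o p = p \o c, p \o s = s \o p,
          forall v, c (p v) = - s (p v) &
          forall v, c (v - p v) = s (v - p v)]].
Proof.
move=> Mc sc; have cl := vN_linear Mc.
have [s [bs ss s0 sscc scomm]] := abs_exists (vN_bounded Mc) sc.
have Ms : M s.
  by apply: vN_intro => // d bd dM; apply: scomm => //; exact: dM.
have sl := vN_linear Ms.
have cscomm : c \o s = s \o c by apply: scomm => //; exact: vN_bounded.
exists s; split=> // p Mp pj pmin.
have pl := vN_linear Mp.
have pc := tr_minimal_commute Mc sc Mp pj pmin.
have ps : p \o s = s \o p by apply: scomm => //; exact: vN_bounded.
split=> //; first exact: tr_minimal_eq_opp_abs pmin.
have [pp sp] := pj.
have Mid := vN_id.
pose p' : H -> H := idfun - p.
have p'E v : p' v = v - p v by [].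
have Mp' : M p' by exact: vNB.
have Mc' : M (- c) by rewrite -scaleN1r; exact: vNZ.
move=> v; apply: oppr_inj; rewrite -p'E.
apply: (@tr_minimal_eq_opp_abs (- c) s p') => //.
- exact: saN.
- by rewrite sscc; apply/funext => x; rewrite /= !fctE (linN cl) opprK.
- by apply/funext => x; rewrite /= !fctE (linN sl) (comp_at cscomm).
- by apply/funext => x; rewrite /= !p'E (linB sl) (comp_at ps).
- apply/funext => x; rewrite /= !fctE !p'E (linB cl) (comp_at pc).
  by rewrite (linN pl) opprB opprK addrC.
- exact: projection_compl.
- move=> a [Ma a0 a1].
  pose a' : H -> H := idfun - a.
  have Ma' : M a' by exact: vNB.
  have au : op_unit_interval dot M a'.
    split=> // x.
      by rewrite subr0; exact: a1.
    have -> : (idfun - a') x = (a - 0) x by rewrite /a' !fctE /= subKr subr0.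
    exact: a0.
  have M1 (x : H -> H) : M x -> M (c \o x) by exact: vN_comp.
  have e (x : H -> H) : M x -> tr ((- c) \o x) = tr (c \o (idfun - x)) - tr c.
    move=> Mx.
    have -> : (- c) \o x = (c \o (idfun - x)) - c.
      apply/funext => y; rewrite /= !fctE /= (linB cl) addrAC subrr add0r //.
    by rewrite trB //; apply: M1; exact: vNB.
  rewrite !e // lerD2r.
  have -> : idfun - p' = p by apply/funext => x; rewrite /p' !fctE /= subKr.
  exact: pmin.
Qed.

(** On the range of qp - qm, both c = s, seen from qm, and c = - s, seen from qp,
    hold; this is why c vanishes there. *)
Lemma tr_minimal_interval c qm qp : M c -> self_adjoint dot c ->
  M qm -> M qp -> projection dot qm -> projection dot qp -> ople dot qm qp ->
  tr_minimal c qm -> tr_minimal c qp ->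
  [/\ ople dot (c \o qm) 0, c \o (qp - qm) = 0, ople dot 0 (c \o (idfun - qp)),
      c \o qm = qm \o c & c \o qp = qp \o c].
Proof.
move=> Mc sc Mm Mp jm jp mp mmin pmin.
have [s [Ms ss s0 hs]] := ex_abs_tr_minimal Mc sc.
have [cm sm nm mm'] := hs _ Mm jm mmin.
have [cp sp np pp] := hs _ Mp jp pmin.
have cl := vN_linear Mc; have ml := vN_linear Mm; have pl := vN_linear Mp.
have [mm sam] := jm; have [ppj sap] := jp.
have px0 v : qp (v - qp v) = 0 by rewrite (linB pl) (comp_at ppj) subrr.
have mx0 v : qm (v - qp v) = 0.
  apply: ip_eq0; apply/eqP; rewrite eq_le ip_ge0 andbT.
  have := ip_ople mp (v - qp v); rewrite px0 [leRHS]/ip linear0l.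
  by rewrite -{1}(comp_at mm) (sa_sym sam).
have mpE v : qm (qp v) = qm v.
  by apply/esym/subr0_eq; rewrite -(linB ml) mx0.
have pmE v : qp (qm v) = qm v.
  apply/esym/subr0_eq/ip_eq0; set z := (X in ip _ X).
  by rewrite ipDl ipNl (sa_sym sap) !(sa_sym sam) mpE subrr.
split=> //.
- apply: ople_ip; [exact: sa_comp|exact: sa0|move=> v].
  rewrite /= nm ipNl {2}/ip linear0l /= oppr_le0.
  by rewrite -(comp_at mm) -(comp_at sm) (sa_sym sam).
- apply/funext => v /=; have -> : (qp - qm) v = qp v - qm (qp v) by rewrite mpE.
  have h1 := mm' (qp v).
  have h2 := np (qp v - qm (qp v)).
  rewrite (linB pl) (comp_at ppj) pmE h1 in h2.
  have : s (qp v - qm (qp v)) + s (qp v - qm (qp v)) = 0 by rewrite {1}h2 addNr.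
  rewrite h1 -mulr2n -scaler_nat => /eqP; rewrite scaler_eq0 pnatr_eq0 /=.
  by move/eqP.
- have cq : c \o (idfun - qp) = (idfun - qp) \o c.
    by apply/funext => v /=; rewrite !fctE (linB cl) (comp_at cp).
  apply: ople_ip; [exact: sa0|apply: sa_comp => //; exact: saB|move=> v].
  rewrite {1}/ip linear0l /= pp.
  have vE : v = (v - qp v) + qp v by rewrite subrK.
  rewrite [X in ip _ X]vE ipDr -(sa_sym sap) (comp_at sp) px0.
  rewrite (lin0 (vN_linear Ms)).
  by rewrite [X in _ + X]/ip linear0l addr0.
Qed.
End VN.
End RealHilbert.

(** * Supporting hyperplanes and spectral pairs *)

Section Hyperplanes.
Set Implicit Arguments.
Unset Strict Implicit.
Unset Printing Implicit Defensive.
Context {R : realType}.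

Definition lform m (c x : 'rV[R]_m) : R := \sum_(i < m) c 0 i * x 0 i.

Lemma in_hyperplane m (c x : 'rV[R]_m) a : hyperplane c a x = (lform c x = a).
Proof. by []. Qed.

Lemma in_upper m (c x : 'rV[R]_m) a :
  upper_half_space c a x = (a <= lform c x) :> Prop.
Proof. by []. Qed.

Lemma in_lower m (c x : 'rV[R]_m) a :
  lower_half_space c a x = (lform c x <= a) :> Prop.
Proof. by []. Qed.

Lemma lformC m (c x : 'rV[R]_m) : lform c x = lform x c.
Proof. by apply: eq_bigr => i _; rewrite mulrC. Qed.

Lemma lformD m (c x y : 'rV[R]_m) : lform c (x + y) = lform c x + lform c y.
Proof. by rewrite -big_split; apply: eq_bigr => i _; rewrite mxE mulrDr. Qed.

Lemma lformZ m k (c x : 'rV[R]_m) : lform c (k *: x) = k * lform c x.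
Proof. by rewrite mulr_sumr; apply: eq_bigr => i _; rewrite mxE mulrCA. Qed.

Lemma lformN m (c x : 'rV[R]_m) : lform c (- x) = - lform c x.
Proof. by rewrite -scaleN1r lformZ mulN1r. Qed.

Lemma lform_gt0 m (c : 'rV[R]_m) : c != 0 -> 0 < lform c c.
Proof.
move=> c0; rewrite lt_def sumr_ge0 ?andbT => [|i _]; last by rewrite -expr2 sqr_ge0.
apply: contra c0 => /eqP h; apply/eqP/rowP => i; rewrite mxE.
have := h => /psumr_eq0P hc; have /eqP := hc (fun j _ => sqr_ge0 (c 0 j)) i isT.
by rewrite sqrf_eq0 => /eqP.
Qed.

(** Moving from x against the normal c leaves the half-space, so x is not
    interior. *)
Lemma support_boundary m (C : set 'rV[R]_m) (c x : 'rV[R]_m) alpha :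
  c != 0 -> C `<=` upper_half_space c alpha -> C x -> hyperplane c alpha x ->
  boundary C x.
Proof.
move=> c0 Cu Cx xa; split; first exact: subset_closure.
move=> /nbhs_ballP [e /= e0 eC].
(* The denominator exceeds every |c_i|, so x - k c stays within e of x. *)
pose k := e / (1 + \sum_(i < m) `|c 0 i|).
have S0 : 0 <= \sum_(i < m) `|c 0 i| by apply: sumr_ge0.
have S1 : 0 < 1 + \sum_(i < m) `|c 0 i| by lra.
have k0 : 0 < k by rewrite divr_gt0.
have /eC/Cu : ball x e (x - k *: c).
  split=> // i j; rewrite /ball /= !mxE (ord1 i) opprB addrC subrK.
  rewrite normrM gtr0_norm // /k mulrAC ltr_pdivrMr // ltr_pM2l //.
  by rewrite (bigD1 j) //= addrCA ltrDl ltr_wpDr // sumr_ge0.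
rewrite in_upper lformD lformN lformZ.
have : lform c x = alpha by [].
have := mulr_gt0 k0 (lform_gt0 c0); lra.
Qed.

Variable n : nat.
Implicit Types (x : 'rV[R]_(1 + n)) (t : 'rV[R]_n) (s : R).

(** The first coordinate changes sign because the hyperplane of the pair (s, t)
    has the equation - s x_0 + t . x = alpha. *)
Definition spectral_normal s t : 'rV[R]_(1 + n) := row_mx (- s)%:M t.

Lemma spectral_formE s t x : lform (spectral_normal s t) x =
  - s * x 0 (lshift n 0) + \sum_(j < n) t 0 j * x 0 (rshift 1 j).
Proof.
rewrite /lform big_split_ord /= big_ord1 row_mxEl mxE eqxx mulr1n; congr (_ + _).
by apply: eq_bigr => j _; rewrite row_mxEr.
Qed.

Lemma spectral_hyperplaneE s t alpha :
  spectral_hyperplane s t alpha = hyperplane (spectral_normal s t) alpha.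
Proof.
by apply/seteqP; split=> x; rewrite !in_hyperplane spectral_formE.
Qed.

Lemma spectral_half_spaceE s t alpha :
  spectral_half_space s t alpha = upper_half_space (spectral_normal s t) alpha.
Proof.
by apply/seteqP; split=> x; rewrite !in_upper spectral_formE.
Qed.

Lemma spectral_normalE (c : 'rV[R]_(1 + n)) :
  c = spectral_normal (- c 0 (lshift n 0)) (rsubmx c).
Proof.
rewrite /spectral_normal opprK -[LHS]hsubmxK; congr row_mx.
by apply/matrixP => i j; rewrite !ord1 !mxE eqxx mulr1n.
Qed.

Lemma spectral_normalD s1 t1 s2 t2 :
  spectral_normal (s1 + s2) (t1 + t2) = spectral_normal s1 t1 + spectral_normal s2 t2.
Proof. by rewrite /spectral_normal add_row_mx opprD raddfD. Qed.

Lemma spectral_normalZ k s t :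
  spectral_normal (k * s) (k *: t) = k *: spectral_normal s t.
Proof. by rewrite /spectral_normal scale_row_mx -mulrN scale_scalar_mx. Qed.

Lemma spectral_normal_inj s1 t1 s2 t2 :
  spectral_normal s1 t1 = spectral_normal s2 t2 -> s1 = s2 /\ t1 = t2.
Proof.
move=> /eq_row_mx [h ->]; split=> //; apply: oppr_inj.
by have := congr1 (fun A : 'M[R]_1 => A 0 0) h; rewrite !mxE eqxx !mulr1n.
Qed.

Lemma spectral_normal_neq0 s t : t != 0 -> spectral_normal s t != 0.
Proof.
apply: contra => /eqP; rewrite /spectral_normal -row_mx0 => /eq_row_mx [_ ->].
exact: eqxx.
Qed.

Lemma independentP s1 t1 s2 t2 : t1 != 0 -> t2 != 0 ->
  independent_spectral_pairs s1 t1 s2 t2 <->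
  ~ exists k, spectral_normal s1 t1 = k *: spectral_normal s2 t2.
Proof.
move=> t10 t20; split.
  move=> [_ _]; rewrite free_cons span_seq1 => /andP[/vlineP h _] [k hk].
  apply: h; exists k; move: hk; rewrite -spectral_normalZ => /spectral_normal_inj [-> ->].
  by rewrite /spectral_vector scale_row_mx scale_scalar_mx.
move=> h; split=> //; rewrite free_cons span_seq1 seq1_free; apply/andP; split.
  apply/vlineP => -[k hk]; apply: h; exists k; rewrite -spectral_normalZ.
  move: hk; rewrite /spectral_vector scale_row_mx scale_scalar_mx => /eq_row_mx [e ->].
  suff -> : s1 = k * s2 by [].
  by have := congr1 (fun A : 'M[R]_1 => A 0 0) e; rewrite !mxE eqxx !mulr1n.
apply: contra t20 => /eqP; rewrite /spectral_vector -row_mx0 => /eq_row_mx [_ ->].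
exact: eqxx.
Qed.

Lemma spectral_support_intro (B F : set 'rV[R]_(1 + n)) s t alpha :
  F !=set0 -> F `<=` B -> t != 0 -> B `<=` spectral_half_space s t alpha ->
  F `<=` spectral_hyperplane s t alpha -> spectral_support B F s t alpha.
Proof.
move=> [x Fx] FB t0 Bh Fh; split=> //.
have c0 := spectral_normal_neq0 s t0.
rewrite spectral_half_spaceE in Bh; rewrite spectral_hyperplaneE in Fh *.
split; last by exists (spectral_normal s t), alpha; split=> //; left.
exists x; split; first exact: Fh.
by apply: support_boundary Bh _ _; [|exact: FB|exact: Fh].
Qed.

(** A hyperplane with B below it has B above it once the equation is negated. *)
Lemma support_normal (B P : set 'rV[R]_(1 + n)) : hyperplane_of_support B P ->
  exists s t alpha, [/\ spectral_normal s t != 0, P = spectral_hyperplane s t alpha &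
    B `<=` spectral_half_space s t alpha].
Proof.
move=> [_ [c [alpha [c0 PE Bc]]]].
wlog Bu : c alpha c0 PE Bc / B `<=` upper_half_space c alpha => [h|].
  case: (Bc) => [|Bl]; first exact: h PE Bc.
  apply: (h (- c) (- alpha)); rewrite ?oppr_eq0 //.
  - rewrite PE; apply/seteqP; split=> x;
      rewrite !in_hyperplane !(lformC (- c)) lformN (lformC x).
      by move=> ->.
    by move/oppr_inj.
  - left => x /Bl; rewrite in_upper in_lower.
    by rewrite (lformC (- c)) lformN (lformC x) lerN2.
  - move => x /Bl; rewrite in_upper in_lower.
    by rewrite (lformC (- c)) lformN (lformC x) lerN2.
exists (- c 0 (lshift n 0)), (rsubmx c), alpha.
by rewrite spectral_hyperplaneE spectral_half_spaceE -spectral_normalE.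
Qed.

(** When the hyperplanes agree, the component d of c1 orthogonal to c2 is a
    direction of the second one, hence of the first, so d is orthogonal to c1 as
    well and must vanish. *)
Lemma hyperplane_neqP (c1 c2 x : 'rV[R]_(1 + n)) alpha1 alpha2 :
  c1 != 0 -> c2 != 0 -> hyperplane c1 alpha1 x -> hyperplane c2 alpha2 x ->
  hyperplane c1 alpha1 <> hyperplane c2 alpha2 <-> ~ exists k, c1 = k *: c2.
Proof.
move=> c10 c20; rewrite !in_hyperplane => <- <-.
rewrite -[X in X <-> _]/(_ -> False) -[X in _ <-> X]/(_ -> False).
have key : (hyperplane c1 (lform c1 x) = hyperplane c2 (lform c2 x)) <->
    exists k, c1 = k *: c2.
  split=> [E|[k ck]].
    pose k := lform c1 c2 / lform c2 c2; exists k.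
    pose d := c1 - k *: c2.
    have d2 : lform c2 d = 0.
      rewrite lformD lformN lformZ (lformC c2) /k divfK ?subrr //.
      by rewrite gt_eqF // lform_gt0.
    have : hyperplane c1 (lform c1 x) (x + d).
      by rewrite E !in_hyperplane lformD d2 addr0.
    rewrite !in_hyperplane lformD => /eqP.
    rewrite -subr_eq0 addrAC subrr add0r => /eqP d1.
    apply/subr0_eq/eqP; apply: contraT => /lform_gt0.
    by rewrite -/d {1}/d lformC lformD lformN lformZ lformC d1 lformC d2 mulr0 subrr ltxx.
  have k0 : k != 0 by apply: contra c10 => /eqP k0; rewrite ck k0 scale0r.
  apply/seteqP; split=> y;
    rewrite !in_hyperplane ck !(lformC (k *: _)) !lformZ !(lformC c2).
    by move/(mulfI k0).
  by move=> ->.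
by split=> h1 h2; apply: h1; apply/key.
Qed.

(** The pairs come from the normals of two distinct supporting hyperplanes. Only
    normals with t = 0 need care, and at most one of the two is of this kind. *)
Lemma sharp_face_spectralP (B F : set 'rV[R]_(1 + n)) :
  is_face B F -> F !=set0 ->
  is_sharp_face B F <->
  exists (s1 s2 : R) (t1 t2 : 'rV[R]_n) (alpha1 alpha2 : R),
     [/\ independent_spectral_pairs s1 t1 s2 t2,
         spectral_support B F s1 t1 alpha1 & spectral_support B F s2 t2 alpha2].
Proof.
move=> faceF F0; have [FB _ _] := faceF; have [x Fx] := F0.
split.
  move=> [_ [P1 [P2 [P12 /support_normal S1 /support_normal S2 FP1 FP2]]]].
  have [s1 [t1 [a1 [c1 E1 U1]]]] := S1; have [s2 [t2 [a2 [c2 E2 U2]]]] := S2.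
  subst P1 P2.
  have ind : ~ exists k, spectral_normal s1 t1 = k *: spectral_normal s2 t2.
    apply/(@hyperplane_neqP _ _ x a1 a2); rewrite -?spectral_hyperplaneE //.
      exact: FP1.
    exact: FP2.
  move=> {P12 S1 S2}.
  wlog t20 : s1 t1 a1 s2 t2 a2 c1 c2 U1 U2 FP1 FP2 ind / t2 != 0 => [wl|].
    have [t2z|t20] := eqVneq t2 0; last exact: (wl s1 t1 a1 s2 t2 a2).
    have [t1z|t10] := eqVneq t1 0.
      have s20 : s2 != 0.
        apply: contra c2 => /eqP ->.
        by rewrite t2z /spectral_normal oppr0 raddf0 row_mx0.
      case: ind; exists (s1 / s2).
      by rewrite -spectral_normalZ t1z t2z scaler0 divfK.
    have [|s [s' [t [t' [a [a' [h1 h2 h3]]]]]]] :=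
      wl _ _ _ _ _ _ c2 c1 U2 U1 FP2 FP1 _ t10; last by exists s, s', t, t', a, a'.
    move=> [k h]; apply: ind; exists k^-1; rewrite h scalerA mulVf ?scale1r //.
    by apply: contra c2 => /eqP k0; rewrite h k0 scale0r.
  have [t10|t10] := eqVneq t1 0; last first.
    exists s1, s2, t1, t2, a1, a2.
    by split; [apply/independentP|exact: spectral_support_intro..].
  (* The first hyperplane is vertical: tilt it by adding the second equation. *)
  exists (s1 + s2), s2, (t1 + t2), t2, (a1 + a2), a2.
  have t120 : t1 + t2 != 0 by rewrite t10 add0r.
  split; [|apply: spectral_support_intro => //|exact: spectral_support_intro].
  - apply/independentP => // -[k]; rewrite spectral_normalD => h; apply: ind.
    by exists (k - 1); rewrite scalerBl scale1r -h addrK.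
  - move=> y By; have := U1 _ By; have := U2 _ By.
    rewrite !spectral_half_spaceE !in_upper.
    rewrite spectral_normalD !(lformC _ y) lformD; lra.
  - move=> y Fy; have := FP1 _ Fy; have := FP2 _ Fy.
    rewrite !spectral_hyperplaneE !in_hyperplane.
    rewrite spectral_normalD !(lformC _ y) lformD; lra.
move=> [s1 [s2 [t1 [t2 [a1 [a2 [ind [S1 _ F1] [S2 _ F2]]]]]]]].
have [t10 t20 _] := ind.
split=> //; exists (spectral_hyperplane s1 t1 a1), (spectral_hyperplane s2 t2 a2).
split=> //; rewrite !spectral_hyperplaneE.
apply/(@hyperplane_neqP _ _ x a1 a2); rewrite -?spectral_hyperplaneE.
- exact: spectral_normal_neq0.
- exact: spectral_normal_neq0.
- exact: F1.
- exact: F2.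
- exact/independentP.
Qed.
End Hyperplanes.

(** * The spectral scale *)

Section SpectralScale.
Set Implicit Arguments.
Unset Strict Implicit.
Unset Printing Implicit Defensive.
Context {R : realType} {H : completeNormedModType R[i]}.
Variable dot : {dot H for Num.conj}.
Hypothesis hdot : hilbert_norm dot.
Variable M : set (H -> H).
Hypothesis hM : von_neumann_algebra dot M.
Variable tau : (H -> H) -> R[i].
Hypothesis htau : faithful_normal_tracial_state dot M tau.
Variables (n : nat) (b : 'I_n -> H -> H).
Hypotheses (hbM : forall j, M (b j)) (hb : forall j, self_adjoint dot (b j)).

Definition spectral_op (s : R) (t : 'rV[R]_n) : H -> H :=
  lin_comb b t - s%:C%C *: idfun.

Lemma lin_comb_vN t : M (lin_comb b t).
Proof.
rewrite /lin_comb; elim/big_ind: _ => [|x y|j _]; first exact: (vN0 hM).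
  exact: (vND hM).
exact: (vNZ hM).
Qed.

Lemma spectral_op_vN s t : M (spectral_op s t).
Proof.
by apply: (vNB hM); [exact: lin_comb_vN|apply: (vNZ hM); exact: (vN_id hM)].
Qed.

Lemma spectral_op_sa s t : self_adjoint dot (spectral_op s t).
Proof.
apply: saB; last by apply: saZ.
rewrite /lin_comb; elim/big_ind: _ => [|x y|j _]; [exact: sa0|exact: saD|].
exact: saZ.
Qed.

(** Linearity of the trace turns a linear form on the spectral scale into the
    trace functional of an element of M; both parts of the theorem meet here. *)
Lemma lform_Psi s t a : M a ->
  lform (spectral_normal s t) (Psi tau b a) = tr tau (spectral_op s t \o a).
Proof.
move=> Ma.
have Mba j : M (b j \o a) by exact: (vN_comp hM).
have -> : spectral_op s t \o a =
    \sum_(j < n) (t 0 j)%:C%C *: (b j \o a) + - (s%:C%C *: a).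
  apply/funext => v; rewrite /spectral_op /lin_comb /= !fctE !fct_sumE.
  by congr (_ + _); apply: eq_bigr.
have [Msum trsum] : M (\sum_(j < n) (t 0 j)%:C%C *: (b j \o a)) /\
   tr tau (\sum_(j < n) (t 0 j)%:C%C *: (b j \o a)) =
   \sum_(j < n) t 0 j * tr tau (b j \o a).
  elim/big_rec2: _ => [|j x y _ [My <-]].
    by split; [exact: (vN0 hM)|rewrite /tr (tau0 hM htau)].
  have Mj := vNZ hM (t 0 j)%:C%C (Mba j).
  by split; [exact: (vND hM Mj My)|rewrite (trD htau) // (trZ hM htau)].
rewrite (trB hM htau) //; last exact: (vNZ hM).
rewrite trsum (trZ hM htau) // spectral_formE /Psi row_mxEl mxE eqxx mulr1n.
rewrite addrC mulNr; congr (_ - _); apply: eq_bigr => j _.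
by rewrite row_mxEr mxE.
Qed.

Lemma projection_unit p : M p -> projection dot p -> op_unit_interval dot M p.
Proof.
move=> Mp hp; have [_ sp] := hp.
split=> //; apply: ople_ip => //; try exact: sa0.
  by move=> v; rewrite (ip_projection v hp) {1}/ip linear0l ip_ge0.
by move=> v; rewrite (ip_projection v hp) ip_projection_le.
Qed.

Lemma ople_refl (a : H -> H) : ople dot a a.
Proof. by move=> v; rewrite subrr linear0l. Qed.

(** Points of F attain the value alpha, which bounds the linear form on B from
    below. *)
Lemma spectral_support_tr_minimal (F : set 'rV[R]_(1 + n)) s t alpha p :
  spectral_support (spectral_scale dot M tau b) F s t alpha ->
  op_unit_interval dot M p -> F (Psi tau b p) -> tr_minimal dot M tau (spectral_op s t) p.
Proof.
rewrite /spectral_support spectral_hyperplaneE spectral_half_spaceE.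
move=> [_ Bu Fh] [Mp _ _] Fp a ua; have [Ma _ _] := ua.
rewrite -!lform_Psi // (Fh _ Fp : lform _ _ = alpha).
by apply: (Bu (Psi tau b a)); exists a.
Qed.
End SpectralScale.

Theorem theorem4p3 (R : realType) (H : completeNormedModType R[i])
    (dot : {dot H for Num.conj}) (hdot : hilbert_norm dot)
    (M : set (H -> H)) (hM : von_neumann_algebra dot M) (hfin : finite_vN dot M)
    (tau : (H -> H) -> R[i]) (htau : faithful_normal_tracial_state dot M tau)
    (n : nat) (hn : (0 < n)%N) (b : 'I_n -> H -> H)
    (hbM : forall j, M (b j)) (hb : forall j, self_adjoint dot (b j))
    (qm qp : H -> H)
    (hqmN : vN_generated dot M (range b `|` [set idfun]) qm)
    (hqpN : vN_generated dot M (range b `|` [set idfun]) qp)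
    (hqm : projection dot qm) (hqp : projection dot qp) (hq : ople dot qm qp) :
  let B := spectral_scale dot M tau b in
  let F := Psi tau b @` op_interval dot M qm qp in
  is_face B F ->
  (is_sharp_face B F <->
   exists (s1 s2 : R) (t1 t2 : 'rV[R]_n) (alpha1 alpha2 : R),
     [/\ independent_spectral_pairs s1 t1 s2 t2,
         spectral_support B F s1 t1 alpha1 & spectral_support B F s2 t2 alpha2])
  /\
  forall (s1 s2 : R) (t1 t2 : 'rV[R]_n) (alpha1 alpha2 : R),
    independent_spectral_pairs s1 t1 s2 t2 ->
    spectral_support B F s1 t1 alpha1 -> spectral_support B F s2 t2 alpha2 ->
    let r1 := qm in
    let r2 := qp - qm in
    let r3 := idfun - qp in
    r1 + r2 + r3 = idfun
    /\
    forall (s : R) (t : 'rV[R]_n),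
      (s, t) = (s1, t1) \/ (s, t) = (s2, t2) ->
      [/\ ople dot (lin_comb b t \o r1) (s%:C%C *: r1),
          lin_comb b t \o r2 = s%:C%C *: r2,
          ople dot (s%:C%C *: r3) (lin_comb b t \o r3) &
          [/\ lin_comb b t \o r1 = r1 \o lin_comb b t,
              lin_comb b t \o r2 = r2 \o lin_comb b t &
              lin_comb b t \o r3 = r3 \o lin_comb b t]].
Proof.
move=> B F faceF.
have subM (q : H -> H) : vN_generated dot M (range b `|` [set idfun]) q -> M q.
  apply; split=> // _ [[j _ <-]|->]; [exact: hbM|exact: (vN_id hM)].
have Mm := subM _ hqmN; have Mp := subM _ hqpN.
have um := projection_unit hdot Mm hqm; have up := projection_unit hdot Mp hqp.
have Fm : F (Psi tau b qm) by exists qm => //; split=> //; exact: ople_refl.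
have Fp : F (Psi tau b qp) by exists qp => //; split=> //; exact: ople_refl.
split; first by apply: sharp_face_spectralP => //; exists (Psi tau b qm).
move=> s1 s2 t1 t2 a1 a2 _ S1 S2 r1 r2 r3; split.
  by rewrite /r1 /r2 /r3 [qm + _]addrC subrK addrC subrK.
move=> s t st.
have [alpha S] : exists alpha, spectral_support B F s t alpha.
  by case: st => -[-> ->]; [exists a1|exists a2].
pose c := spectral_op b s t.
have Mc : M c by exact: (spectral_op_vN hM).
have sc : self_adjoint dot c by exact: (spectral_op_sa hb).
have cE (x : H -> H) v : lin_comb b t (x v) = c (x v) + s%:C%C *: x v.
  by rewrite /c /spectral_op !fctE subrK.
have [c1 c2 c3 cm cp] := tr_minimal_interval hdot hM htau Mc sc Mm Mp hqm hqp hq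
  (spectral_support_tr_minimal hM htau hbM S um Fm)
  (spectral_support_tr_minimal hM htau hbM S up Fp).
have ml := vN_linear hM Mm; have pl := vN_linear hM Mp.
have Ml := vN_linear hM (lin_comb_vN hM hbM t).
have bm : lin_comb b t \o qm = qm \o lin_comb b t.
  apply/funext => v /=.
  by rewrite cE (comp_at cm) (cE idfun) (linD ml) (linZ ml).
have bp : lin_comb b t \o qp = qp \o lin_comb b t.
  apply/funext => v /=.
  by rewrite cE (comp_at cp) (cE idfun) (linD pl) (linZ pl).
split.
- move=> v.
  have -> : (s%:C%C *: r1 - (lin_comb b t \o r1)) v = (0 - (c \o qm)) v.
    by rewrite !fctE /= cE opprD [LHS]addrCA subrr addr0 add0r.
  exact: c1.
- apply/funext => v; rewrite [LHS](cE r2).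
  by rewrite (congr1 (fun f : H -> H => f v) c2 : c (r2 v) = 0) add0r.
- move=> v.
  have -> : ((lin_comb b t \o r3) - s%:C%C *: r3) v
      = ((c \o (idfun - qp)) - 0) v.
    by rewrite !fctE /= cE addrK subr0.
  exact: c3.
split=> //; apply/funext => v; rewrite /r2 /r3 /= !fctE (linB Ml).
- by rewrite (comp_at bm) (comp_at bp).
- by rewrite (comp_at bp).
Qed.
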